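(* Let $p$ be a prime, let $\nu\ge 2$, and let $n_0,n_1,\ldots,n_\nu$ be positive integers. Put $$d=\gcd(n_1-n_0,\ldots,n_\nu-n_0,p-1),\qquad e=\gcd(d,n_0),\qquad \Delta=d/e,$$ $$D=\min_{0\le i\le\nu}\max_{j\ne i}\gcd(n_j-n_i,p-1),\qquad \Gamma=(p-1)/D.$$ Then $$M_{n_0,\ldots,n_\nu}\lesssim\begin{cases}\Delta^{-1/4}\Gamma^{-1/(4\nu)}p^{7/6}, & \text{if } p^{29/48}\le \Delta<p^{2/3},\\ \Delta^{-21/52}\Gamma^{-1/(4\nu)}p^{131/104}, & \text{if } p^{59/112}\le \Delta<p^{29/48},\\ \Delta^{-7/20}\Gamma^{-1/(4\nu)}p^{197/160}, & \text{if } p^{1/2}\le \Delta<p^{59/112},\\ \Delta^{-31/80}\Gamma^{-1/(4\nu)}p^{5/4}, & \text{if } \Delta<p^{1/2}.\end{cases}$$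
   Context: For a prime $p$ write ${\mathbf{\,e}}_p(x)=e^{2\pi i x/p}$. For positive integers $n_0,\ldots,n_\nu$ and integers $a_0,\ldots,a_\nu$ let $$S_{n_0,\ldots,n_\nu}(a_0,\ldots,a_\nu)=\sum_{x=0}^{p-1}{\mathbf{\,e}}_p(a_0x^{n_0}+\cdots+a_\nu x^{n_\nu}),$$ and $$M_{n_0,\ldots,n_\nu}=\max_{\substack{a_0,\ldots,a_\nu\in\mathbb Z\\ \gcd(a_0a_1\cdots a_\nu,\,p)=1}}\left|S_{n_0,\ldots,n_\nu}(a_0,\ldots,a_\nu)\right|.$$ The notation $A\lesssim B$ means $A\le p^{o(1)}B$ as $p\to\infty$ (the $o(1)$ term tending to $0$ as $p\to\infty$, uniformly in the other parameters). *)

(* Defs.v *)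
From HB Require Import structures.
From mathcomp Require Import all_boot all_order all_algebra.
From mathcomp Require Import complex.
From mathcomp Require Import all_classical all_reals all_analysis.
Import Order.TTheory GRing.Theory Num.Theory.
Import numFieldNormedType.Exports.
Import Normc.
Set Implicit Arguments.
Unset Strict Implicit.
Unset Printing Implicit Defensive.

Local Open Scope classical_set_scope.
Local Open Scope ring_scope.
Local Open Scope complex_scope.

(* A family n_0, ..., n_nu (or a_0, ..., a_nu) is a function on 'I_nu.+1, and
   n_0 is n ord0. *)

(* e^{2 pi i x / p}; the libraries have no complex exponential, so it is given
   by its real and imaginary parts. *)
Definition ep (R : realType) (p : nat) (x : int) : R[i] :=
  let t : R := 2 * pi * x%:~R / p%:R in cos t +i* sin t.

Definition expsum (R : realType) (p nu : nat) (n : 'I_nu.+1 -> nat)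
    (a : 'I_nu.+1 -> int) : R[i] :=
  \sum_(x < p) ep R p (\sum_(i < nu.+1) a i * (x%:Z) ^+ n i).

Definition expsum_norms (R : realType) (p nu : nat) (n : 'I_nu.+1 -> nat) :
    set R :=
  [set normc (expsum R p n a) |
     a in [set a : 'I_nu.+1 -> int | coprimez (\prod_(i < nu.+1) a i) p%:Z]].

Arguments expsum_norms R p {nu} n _.

(* The supremum is a maximum, see maxsum_attained and maxsum_ub below. *)
Definition maxsum (R : realType) (p nu : nat) (n : 'I_nu.+1 -> nat) : R :=
  sup (expsum_norms R p n).

(* gcd(n_j - n_i, p - 1); equal to p - 1 when n_j = n_i. *)
Definition gcd_diff (p nu : nat) (n : 'I_nu.+1 -> nat) (i j : 'I_nu.+1) : nat :=
  gcdn `|n j - n i|%N p.-1.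

Definition dpar (p nu : nat) (n : 'I_nu.+1 -> nat) : nat :=
  gcdn (\big[gcdn/0%N]_(i < nu.+1 | i != ord0) `|n i - n ord0|%N) p.-1.

Definition epar (p nu : nat) (n : 'I_nu.+1 -> nat) : nat :=
  gcdn (dpar p n) (n ord0).

(* The quotients in Deltapar and Gammapar are exact: epar divides dpar, and Dpar
   divides p - 1 as soon as nu > 0. *)
Definition Deltapar (p nu : nat) (n : 'I_nu.+1 -> nat) : nat :=
  dpar p n %/ epar p n.

Definition maxgcd (p nu : nat) (n : 'I_nu.+1 -> nat) (i : 'I_nu.+1) : nat :=
  \max_(j < nu.+1 | j != i) gcd_diff p n i j.

Definition Dpar (p nu : nat) (n : 'I_nu.+1 -> nat) : nat :=
  \big[minn/maxgcd p n ord0]_(i < nu.+1) maxgcd p n i.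

Definition Gammapar (p nu : nat) (n : 'I_nu.+1 -> nat) : nat :=
  p.-1 %/ Dpar p n.

Lemma cosDz (R : realType) (t : R) (k : int) : cos (t + 2 * pi * k%:~R) = cos t.
Proof.
have H (u : R) (m : nat) : cos (u + 2 * pi * m%:R) = cos u.
  by rewrite mulr_natr mulr_natl (periodicn (@cosD2pi R)).
case: k => m; first exact: H.
rewrite NegzE mulrNz mulrN -[LHS](H _ m.+1); by rewrite subrK.
Qed.

Lemma sinDz (R : realType) (t : R) (k : int) : sin (t + 2 * pi * k%:~R) = sin t.
Proof.
have H (u : R) (m : nat) : sin (u + 2 * pi * m%:R) = sin u.
  by rewrite mulr_natr mulr_natl (periodicn (@sinD2pi R)).
case: k => m; first exact: H.
rewrite NegzE mulrNz mulrN -[LHS](H _ m.+1); by rewrite subrK.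
Qed.

Lemma ep_eqmod (R : realType) (p : nat) (x y : int) :
  (0 < p)%N -> (x = y %[mod p])%Z -> ep R p x = ep R p y.
Proof.
move=> p0 /eqP; rewrite eqz_mod_dvd => /dvdzP[k /eqP].
rewrite subr_eq addrC => /eqP ->; rewrite /ep.
have -> : 2 * pi * (y + k * p%:Z)%:~R / p%:R =
          2 * pi * y%:~R / p%:R + 2 * pi * k%:~R :> R.
  rewrite intrD intrM mulrDr mulrDl; congr (_ + _).
  by rewrite mulrA mulfK// pnatr_eq0 -lt0n.
by rewrite cosDz sinDz.
Qed.

Lemma expsum_eqmod (R : realType) (p nu : nat) (n : 'I_nu.+1 -> nat)
    (a b : 'I_nu.+1 -> int) :
  (0 < p)%N -> (forall i, (a i = b i %[mod p])%Z) ->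
  expsum R p n a = expsum R p n b.
Proof.
move=> p0 ab; apply: eq_bigr => x _; apply: ep_eqmod => //.
apply/eqP; rewrite eqz_mod_dvd -sumrB; apply: rpred_sum => i _.
by rewrite -mulrBl dvdz_mulr// -eqz_mod_dvd; apply/eqP.
Qed.

Lemma expsum_norms_finite (R : realType) (p nu : nat) (n : 'I_nu.+1 -> nat) :
  (0 < p)%N -> finite_set (expsum_norms R p n).
Proof.
move=> p0.
pose f (b : {ffun 'I_nu.+1 -> 'I_p}) :=
  normc (expsum R p n (fun i => (b i)%:Z)).
apply: (@sub_finite_set _ _ (f @` setT)); last first.
  exact: finite_image (@finite_finset _ _).
move=> _ [a _ <-].
have lt i : (`|(a i %% p)%Z| < p)%N.
  rewrite -ltz_nat gez0_abs ?ltz_pmod// modz_ge0//.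
  by rewrite eqz_nat -lt0n.
exists [ffun i => Ordinal (lt i)] => //; rewrite /f.
congr normc; apply: expsum_eqmod => // i; rewrite ffunE /=.
by rewrite gez0_abs ?modz_mod// modz_ge0// eqz_nat -lt0n.
Qed.

Lemma expsum_norms_neq0 (R : realType) (p nu : nat) (n : 'I_nu.+1 -> nat) :
  expsum_norms R p n !=set0.
Proof.
exists (normc (expsum R p n (fun=> 1))), (fun=> 1) => //=.
by rewrite big1 // /coprimez gcd1z.
Qed.

Lemma maxsum_ub (R : realType) (p nu : nat) (n : 'I_nu.+1 -> nat) :
  (0 < p)%N -> ubound (expsum_norms R p n) (maxsum R p n).
Proof.
move=> p0; apply: sup_upper_bound; split; first exact: expsum_norms_neq0.
have /finite_seqP[s ->] := @expsum_norms_finite R p nu n p0.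
exists (\sum_(y <- s) `|y|) => x /= xs.
rewrite (big_rem x)//= (le_trans (ler_norm x))// lerDl sumr_ge0//.
Qed.

Lemma maxsum_attained (R : realType) (p nu : nat) (n : 'I_nu.+1 -> nat) :
  (0 < p)%N -> expsum_norms R p n (maxsum R p n).
Proof.
move=> p0; have ub := @maxsum_ub R p nu n p0.
have [y Sy ymax] : exists2 y, expsum_norms R p n y &
    ubound (expsum_norms R p n) y.
  have := @expsum_norms_neq0 R p nu n.
  have /finite_seqP[s ->] := @expsum_norms_finite R p nu n p0.
  elim: s => [[]//|x s IH] _.
  have [->|s0] := eqVneq s [::].
    by exists x => [|z]; rewrite /= inE ?eqxx// => /eqP ->.
  have [|y ys ymax] := IH.
    by case: s s0 {IH} => // z s _; exists z; rewrite /= inE eqxx.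
  have [xy|/ltW yx] := leP x y.
    exists y => [|z]; rewrite /= inE; first by rewrite ys orbT.
    by case/predU1P => [->//|/ymax].
  exists x => [|z]; rewrite /= inE ?eqxx//.
  by case/predU1P => [->//|/ymax zy]; apply: le_trans zy yx.
suff -> : maxsum R p n = y by [].
apply/eqP; rewrite eq_le ub// andbT.
by apply: ge_sup => //; exact: expsum_norms_neq0.
Qed.

(* Main.v *)
(** The subgroup H = {h : h^Delta = 1} of F_p^* consists of the values y^{n_0}
    with y^d = 1, and x |-> x y multiplies f(x) = sum_i a_i x^{n_i} by y^{n_0}.
    Averaging over H gives
      |S| <= #{x : f(x) = 0} + (p / Delta) max_{c <> 0} |sum_{h in H} e_p(c h)|.
    - By Stepanov's method #{x : x^t = (x - a)^t = 1} << t^{2/3} for t^4 <= p^3;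
      with Cauchy-Schwarz and Parseval the Gauss sums are << p^{1/4} Delta^{5/12}.
    - By Dirichlet's approximation theorem some substitution x = v u^k turns f
      into Laurent polynomials in u of degree << p Gamma^{-1/nu}, so f has
      << p Gamma^{-1/nu} zeros.
    As Delta divides every gcd(n_j - n_i, p - 1), one has Delta Gamma < p, hence
    Gamma^{-1/(4 nu)} >= (Delta / p)^{1/8} since nu >= 2.  With this lower bound
    for the right-hand sides, the estimate
      |S| << p Gamma^{-1/nu} + p^{5/4} Delta^{-7/12}
    is at least as strong as all four claimed bounds when Delta >= p^{2/5}, and
    for Delta < p^{2/5} the trivial bound |S| <= p suffices. *)

Require Import Defs.
From HB Require Import structures.
From mathcomp Require Import all_boot all_order all_algebra all_field.
From mathcomp Require Import cyclic complex.
From mathcomp Require Import all_classical all_reals all_analysis.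
From mathcomp Require Import ring lra zify.
Import Order.TTheory GRing.Theory Num.Theory.
Import numFieldNormedType.Exports.
Import Normc.
Set Implicit Arguments.
Unset Strict Implicit.
Unset Printing Implicit Defensive.
Local Open Scope ring_scope.

(** * Stepanov's method *)

Lemma pchar_natr_inj (F : fieldType) (p i j : nat) :
  p \in [pchar F] -> (i < p)%N -> (j < p)%N -> i%:R = j%:R :> F -> i = j.
Proof.
move=> charF.
wlog le_ij : i j / (i <= j)%N => [th ip jp eij|ip jp eij].
  by case/orP: (leq_total i j) => le; [exact: th|apply/esym/th].
have : (p %| j - i)%N by rewrite (dvdn_pcharf charF) natrB// eij subrr.
by move=> /dvdnP[[|k] ek]; nia.
Qed.

Lemma dvdp_exp_deriv (F : fieldType) (a : F) (q : {poly F}) (m : nat) :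
  ('X - a%:P) ^+ m.+1 %| q -> ('X - a%:P) ^+ m %| q^`().
Proof.
case/dvdpP=> g ->; rewrite derivM deriv_exp derivXsubC mul1r /=.
by rewrite -mulr_natr mulrCA dvdp_add ?dvdp_mulIl// exprS mulrA dvdp_mulIr.
Qed.

(* The operator q |-> X q' - v q kills the monomial X^v and lowers the order of
   vanishing at a by at most one. *)
Lemma sparse_poly_order (F : fieldType) (p : nat) (a : F) (s : seq nat)
    (q : {poly F}) :
  p \in [pchar F] -> a != 0 -> all (fun k => k < p)%N s ->
  (forall k, q`_k != 0 -> k \in s) -> ('X - a%:P) ^+ size s %| q -> q = 0.
Proof.
move=> charF a0; elim: s q => [|v s IH] q /=.
  move=> _ qs _; apply/polyP => k; rewrite coef0; apply/eqP.
  by case: eqP => // /eqP /qs; rewrite in_nil.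
case/andP => vp sp qs dvd.
have q1k k : ('X * q^`() - v%:R *: q)`_k = (k%:R - v%:R) * q`_k.
  rewrite coefB coefZ coefXM; case: k => [|k] /=; 
    first by rewrite sub0r mulrBl mul0r sub0r.
  by rewrite coef_deriv mulrBl !mulr_natl.
have q10 : 'X * q^`() - v%:R *: q = 0.
  apply: IH => // [j|].
    rewrite q1k mulf_eq0 negb_or subr_eq0 => /andP[jv /qs].
    by rewrite inE => /predU1P[ejv|//]; rewrite ejv eqxx in jv.
  rewrite dvdp_sub//; first by rewrite dvdp_mull// dvdp_exp_deriv.
  by rewrite -mul_polyC dvdp_mull// (dvdp_trans _ dvd)// dvdp_exp2l.
(* Exponents below p stay distinct in characteristic p, so [X q' = v q] leaves only the monomial
   X^v, which has no zero at a != 0. *)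
have qk k : k != v -> q`_k = 0.
  move=> kv; apply/eqP/negP => /negP qk0.
  have := qs k qk0; rewrite inE (negPf kv) /= => /(allP sp) kp.
  have /eqP := q1k k; rewrite q10 coef0 eq_sym mulf_eq0 (negPf qk0) orbF.
  by rewrite subr_eq0 => /eqP /(pchar_natr_inj charF kp vp) /eqP; rewrite (negPf kv).
have eq : q = q`_v *: 'X^v.
  apply/polyP => k; rewrite coefZ coefXn; case: eqVneq => [->|/qk ->].
    by rewrite mulr1.
  by rewrite mulr0.
have /eqP : q.[a] = 0.
  apply/eqP; rewrite -/(root q a) -dvdp_XsubCl; apply: dvdp_trans dvd.
  by rewrite exprS dvdp_mulIl.
rewrite eq hornerZ hornerXn mulf_eq0 expf_eq0 (negPf a0) andbF orbF => /eqP ->.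
by rewrite scale0r.
Qed.

(** The sum is read as a Y-adic expansion: Y divides every term but [G ord0], hence divides [G ord0]
    too and kills it. Cancel a factor Y and induct. *)
Lemma sum_expr_dvd_eq0 (F : fieldType) (Y : {poly F}) (n : nat)
    (G : 'I_n -> {poly F}) :
  Y != 0 -> (forall c, Y %| G c -> G c = 0) ->
  \sum_(c < n) G c * Y ^+ c = 0 -> forall c, G c = 0.
Proof.
move=> Y0; elim: n G => [G _ _ []//|n IH] G dvdG.
rewrite big_ord_recl expr0 mulr1.
under eq_bigr do rewrite lift0 exprSr mulrA.
rewrite -mulr_suml => sum0.
have G0 : G ord0 = 0.
  apply: dvdG; move/eqP: sum0; rewrite addr_eq0 => /eqP ->.
  by rewrite -mulNr dvdp_mulIr.
move/eqP: sum0; rewrite G0 add0r mulf_eq0 (negPf Y0) orbF => /eqP sum0 c.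
case: (unliftP ord0 c) => [j ->|-> //].
by apply: (IH (fun i => G (lift ord0 i))) => // i; exact: dvdG.
Qed.

Lemma coef_sum_mulXn (F : fieldType) (t B : nat) (f : 'I_B -> {poly F})
    (b : 'I_B) (i : nat) :
  (forall b, (size (f b) <= t)%N) -> (i < t)%N ->
  (\sum_(b < B) f b * 'X^(t * b))`_(i + t * b) = (f b)`_i.
Proof.
move=> sf it; rewrite coef_sum (bigD1 b)//= big1 ?addr0 => [|c cb].
  by rewrite coefMXn ltnNge leq_addl addnK.
rewrite coefMXn; case: ltnP => // le.
have cb' : (c < b)%N.
  have ne : nat_of_ord c <> b by move/val_inj/eqP; apply/negP.
  nia.
apply/nth_default/(leq_trans (sf c)); nia.
Qed.

(** This keeps the auxiliary polynomial from vanishing identically. The coefficient of (X - a)^(t c)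
    has at most A B <= t monomials, of exponents below t B <= p. By [sparse_poly_order] it is zero
    once (X - a)^t divides it, so all these coefficients vanish. As A <= t, the blocks X^(t b)
    [f b c] do not overlap, and each [f b c] vanishes as well. *)
Lemma stepanov_free (F : fieldType) (p A B t : nat) (a : F)
    (f : 'I_B -> 'I_B -> {poly F}) :
  p \in [pchar F] -> a != 0 -> (A * B <= t)%N -> (t * B <= p)%N ->
  (forall b c, size (f b c) <= A)%N ->
  \sum_(c < B) (\sum_(b < B) f b c * 'X^(t * b)) * ('X - a%:P) ^+ (t * c) = 0 ->
  forall b c, f b c = 0.
Proof.
move=> charF a0 ABt tBp sf sum0 b c.
have lAt : (A <= t)%N by case: b => i /=; nia.
have G0 : \sum_(b < B) f b c * 'X^(t * b) = 0.
  apply: (@sum_expr_dvd_eq0 _ (('X - a%:P) ^+ t) B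
      (fun c => \sum_(b < B) f b c * 'X^(t * b))).
  - by rewrite expf_neq0// polyXsubC_eq0.
  - move=> {}c dvd; pose s := [seq (i + t * j)%N | i <- iota 0 A, j <- iota 0 B].
    apply: (@sparse_poly_order _ p a s) => //.
    + apply/allP => k /allpairsP[[i j]] /=; rewrite !mem_iota /= !add0n => -[iA jB ->].
      nia.
    + move=> k; apply: contraNT => ks; rewrite coef_sum big1 // => j _.
      rewrite coefMXn; case: ltnP => // le; apply: nth_default.
      apply: leq_trans (sf j c) _; rewrite leqNgt; apply: contra ks => ks.
      apply/allpairsP; exists ((k - t * j)%N, nat_of_ord j).
      by rewrite !mem_iota /= !add0n ks ltn_ord subnK.
    + by apply: dvdp_trans dvd; rewrite dvdp_exp2l// size_allpairs !size_iota.
  - by rewrite -[RHS]sum0; apply: eq_bigr => {}c _; rewrite exprM.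
apply/polyP => i; rewrite coef0; case: (ltnP i A) => iA; last first.
  by apply: nth_default; apply: leq_trans iA.
rewrite -(@coef_sum_mulXn _ t B (f^~ c) b) ?G0 ?coef0//.
  by move=> b'; apply: leq_trans (sf b' c) _.
exact: leq_trans lAt.
Qed.

(* This derivation acts on f X^m (X - a)^n through the cofactor f alone, raising
   its degree by at most one: see theta_monomial. *)
Definition theta (F : fieldType) (a : F) (q : {poly F}) : {poly F} :=
  'X * ('X - a%:P) * q^`().

Definition theta_coef (F : fieldType) (a : F) (m n : nat) (f : {poly F}) :
    {poly F} :=
  theta a f + (m%:R *: ('X - a%:P) + n%:R *: 'X) * f.

Lemma theta_monomial (F : fieldType) (a : F) (m n : nat) (f : {poly F}) :
  theta a (f * 'X^m * ('X - a%:P) ^+ n) =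
  theta_coef a m n f * 'X^m * ('X - a%:P) ^+ n.
Proof.
have E (y : {poly F}) k : y * (y ^+ k.-1 *+ k) = k%:R * y ^+ k.
  by case: k => [|k]; rewrite ?mulr0n ?mulr0 ?mul0r// -mulr_natl mulrCA -exprS.
rewrite /theta_coef /theta !derivM derivXn deriv_exp derivXsubC mul1r.
rewrite -!mul_polyC !rmorph_nat.
have := E 'X m; have := E ('X - a%:P) n.
move: ('X^(m.-1) *+ m) (_ ^+ n.-1 *+ n) ('X^m) (_ ^+ n) => u v U V Ev Eu.
transitivity ('X * ('X - a%:P) * f^`() * U * V + f * (('X - a%:P) * V * ('X * u)
   + 'X * U * (('X - a%:P) * v))); first by ring.
by rewrite Eu Ev; ring.
Qed.

Lemma iter_theta_monomial (F : fieldType) (a : F) (m n k : nat) (f : {poly F}) :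
  iter k (theta a) (f * 'X^m * ('X - a%:P) ^+ n) =
  iter k (theta_coef a m n) f * 'X^m * ('X - a%:P) ^+ n.
Proof. by elim: k => //= k ->; rewrite theta_monomial. Qed.

Lemma iter_theta_sum (F : fieldType) (a : F) (k : nat) (I : finType)
    (f : I -> {poly F}) :
  iter k (theta a) (\sum_i f i) = \sum_i iter k (theta a) (f i).
Proof.
by elim: k => //= k ->; rewrite /theta raddf_sum mulr_sumr.
Qed.

Lemma iter_theta_coefB (F : fieldType) (a : F) (m n k : nat) (f g : {poly F}) :
  iter k (theta_coef a m n) (f - g) =
  iter k (theta_coef a m n) f - iter k (theta_coef a m n) g.
Proof.
by elim: k => //= k ->; rewrite /theta_coef /theta derivB; ring.
Qed.

Lemma size_theta_coef (F : fieldType) (a : F) (m n k : nat) (f : {poly F}) :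
  (size (iter k (theta_coef a m n) f) <= size f + k)%N.
Proof.
elim: k => [|k IH] /=; first by rewrite addn0.
set g := iter _ _ _ in IH *; apply: leq_trans (_ : (size g).+1 <= _)%N; last first.
  by rewrite addnS ltnS.
have [->|g0] := eqVneq g 0.
  by rewrite /theta_coef /theta deriv0 !mulr0 addr0 size_poly0.
apply: leq_trans (size_polyD _ _) _; rewrite geq_max; apply/andP; split.
  apply: leq_trans (size_polyMleq _ _) _.
  have := lt_size_deriv g0.
  rewrite size_Mmonic ?monicXsubC ?polyX_eq0// size_polyX size_XsubC /=; lia.
apply: leq_trans (size_polyMleq _ _) _.
rewrite -[(size g).+1]/(2 + size g).-1 -!subn1 leq_sub2r// leq_add2r.
apply: leq_trans (size_polyD _ _) _; rewrite geq_max.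
by rewrite !(leq_trans (size_scale_leq _ _))// ?size_XsubC ?size_polyX.
Qed.

(** Away from 0 and a, [theta] detects multiplicities up to p as the derivative does. If q = g (X -
    x)^m with 0 < m < p, then modulo (X - x)^m the only term of [theta a q] is m X (X - a) g (X -
    x)^(m-1), so (X - x)^m | [theta a q] forces g(x) = 0. *)
Lemma root_theta_order (F : fieldType) (p D : nat) (a x : F) (q : {poly F}) :
  p \in [pchar F] -> (D <= p)%N -> x != 0 -> x != a ->
  (forall k, (k < D)%N -> root (iter k (theta a) q) x) ->
  ('X - x%:P) ^+ D %| q.
Proof.
move=> charF; elim: D q => [|D IH] q Dp x0 xa rq; first by rewrite expr0 dvd1p.
have /dvdpP[g eg] : ('X - x%:P) ^+ D %| q.
  by apply: IH => // [|k kD]; [exact: ltnW|apply: rq; exact: ltnW].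
have dth : ('X - x%:P) ^+ D %| theta a q.
  apply: IH => // [|k kD]; first exact: ltnW.
  by rewrite -iterSr; exact: rq.
rewrite eg exprS dvdp_mul// dvdp_XsubCl.
case: D => [|D] in IH Dp rq eg dth *.
  by have := rq 0%N isT; rewrite /= eg expr0 mulr1.
move: dth; rewrite eg /theta derivM deriv_exp derivXsubC mul1r /=.
have -> : 'X * ('X - a%:P) *
      (g^`() * ('X - x%:P) ^+ D.+1 + g * (('X - x%:P) ^+ D *+ D.+1)) =
    (('X - x%:P) * ('X * ('X - a%:P) * g^`()) +
     'X * ('X - a%:P) * g * D.+1%:R) * ('X - x%:P) ^+ D.
  by rewrite exprS -mulr_natr; ring.
rewrite exprS dvdp_mul2r ?expf_neq0 ?polyXsubC_eq0// dvdp_addr ?dvdp_mulIl//.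
rewrite dvdp_XsubCl /root !hornerE /= -[D.+1%:R]polyC_natr hornerC.
rewrite !mulf_eq0 subr_eq0 (negPf x0) (negPf xa) orbF /=.
by rewrite -(dvdn_pcharf charF) gtnNdvd// ?orbF.
Qed.

Lemma dvdp_prod_XsubC_exp (F : fieldType) (D : nat) (s : seq F) (q : {poly F}) :
  uniq s -> (forall x, x \in s -> ('X - x%:P) ^+ D %| q) ->
  (\prod_(x <- s) ('X - x%:P)) ^+ D %| q.
Proof.
elim: s => [|x s IH] /= => [_ _|/andP[xs us] dq].
  by rewrite big_nil expr1n dvd1p.
rewrite big_cons exprMn Gauss_dvdp ?dq ?mem_head//=.
  by apply: IH => // y ys; rewrite dq// inE ys orbT.
rewrite coprimep_expl// coprimep_expr// coprimep_sym coprimep_XsubC.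
by rewrite root_prod_XsubC.
Qed.

Lemma size_sum_leq (F : fieldType) (I : finType) (f : I -> {poly F}) (n : nat) :
  (forall i, size (f i) <= n)%N -> (size (\sum_i f i)%R <= n)%N.
Proof.
by move=> fn; apply: leq_trans (size_sum _ _ _) _; apply/bigmax_leqP => i _.
Qed.

(** A B^2 unknown coefficients face D (A + D) linear conditions, since each of the D sums has size
    at most A + D. A pigeonhole on coefficient families replaces linear algebra: two of them have
    the same image, and their difference is the solution. The factors X^(t b) and (X - a)^(t c) are
    left out because they equal 1 at the points to be counted. *)
Lemma stepanov_aux (F : finFieldType) (A B D t : nat) (a : F) :
  (D * (A + D) < A * B * B)%N ->
  exists f : 'I_B -> 'I_B -> {poly F},
  [/\ forall b c, (size (f b c) <= A)%N, exists b c, f b c != 0 &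
      forall k, (k < D)%N ->
        \sum_(b < B) \sum_(c < B) iter k (theta_coef a (t * b) (t * c)) (f b c) = 0].
Proof.
move=> lt.
pose f (u : {ffun 'I_A * ('I_B * 'I_B) -> F}) b c : {poly F} :=
  \poly_(i < A) oapp (fun i => u (i, (b, c))) 0 (insub i).
pose E u k :=
  \sum_(b < B) \sum_(c < B) iter k (theta_coef a (t * b) (t * c)) (f u b c).
pose ev u : {ffun 'I_D * 'I_(A + D) -> F} :=
  [ffun ki : 'I_D * 'I_(A + D) => (E u ki.1)`_ki.2].
have sf u b c : (size (f u b c) <= A)%N by exact: size_poly.
have sE u k : (k < D)%N -> (size (E u k) <= A + D)%N.
  move=> kD; apply: size_sum_leq => b; apply: size_sum_leq => c.
  apply: leq_trans (size_theta_coef _ _ _ _ _) _.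
  by rewrite leq_add// ltnW.
have /injectivePn[u [v uv /ffunP euv]] : ~~ injectiveb ev.
  apply/negP => /injectiveP /leq_card; rewrite !card_ffun !card_prod !card_ord.
  by rewrite leqNgt ltn_exp2l ?card_finNzRing_gt1// mulnA lt.
exists (fun b c => f u b c - f v b c); split.
- by move=> b c; rewrite (leq_trans (size_polyD _ _))// geq_max size_polyN !sf.
- have [[i [b c]] ne] : exists ibc, u ibc != v ibc.
    apply/existsP; apply: contraNT uv; rewrite negb_exists => /forallP h.
    by apply/eqP/ffunP => ibc; apply/eqP; rewrite -[_ == _]negbK.
  exists b, c; apply: contra ne; rewrite subr_eq0 => /eqP/polyP/(_ i).
  by rewrite !coef_poly ltn_ord !valK /= => ->.
- move=> k kD; transitivity (E u k - E v k).
    rewrite -sumrB; apply: eq_bigr => b _; rewrite -sumrB; apply: eq_bigr => c _.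
    exact: iter_theta_coefB.
  apply/eqP; rewrite subr_eq0; apply/eqP/polyP => i.
  have [iA|Ai] := ltnP i (A + D)%N.
    by have := euv (Ordinal kD, Ordinal iA); rewrite !ffunE.
  by rewrite !nth_default// (leq_trans _ Ai)// sE.
Qed.

(** The polynomial [Psi] is nonzero by [stepanov_free], has size at most 2 t B, and vanishes to
    order D at every counted point. *)
Lemma stepanov_count (F : finFieldType) (p A B D t : nat) (a : F) :
  p \in [pchar F] -> a != 0 -> (A * B <= t)%N -> (t * B <= p)%N -> (D <= p)%N ->
  (D * (A + D) < A * B * B)%N ->
  (#|[set x : F | ((x ^+ t == 1) && ((x - a) ^+ t == 1))%R]| * D <= 2 * t * B)%N.
Proof.
move=> charF a0 ABt tBp Dp lt; have [f [sf [b [c fbc]] Ef]] := stepanov_aux t a lt.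
set Z := [set x | _]; pose Psi := \sum_(b < B) \sum_(c < B)
  f b c * 'X^(t * b) * ('X - a%:P) ^+ (t * c).
have t0 : (0 < t)%N by have := lt; case: (A) ABt => [|A']; nia.
have B0 : (0 < B)%N by case: b {fbc} => i /=; lia.
have Psi0 : Psi != 0.
  apply: contra fbc => /eqP e0; apply/eqP.
  apply: (stepanov_free charF a0 ABt tBp sf); rewrite -[RHS]e0 /Psi exchange_big.
  by apply: eq_bigr => j _; rewrite mulr_suml.
have sPsi : (size Psi <= 2 * t * B)%N.
  apply: size_sum_leq => i; apply: size_sum_leq => j.
  apply: leq_trans (size_polyMleq _ _) _; rewrite size_exp_XsubC addnS /=.
  apply: leq_trans (leq_add (size_polyMleq _ _) (leqnn _)) _.
  rewrite size_polyXn addnS /=.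
  have := sf i j; have := ltn_ord i; have := ltn_ord j.
  move: (size _) (nat_of_ord i) (nat_of_ord j) => s k l; nia.
have dPsi : (\prod_(x <- enum Z) ('X - x%:P)) ^+ D %| Psi.
  apply: dvdp_prod_XsubC_exp => [|x]; first exact: enum_uniq.
  rewrite mem_enum inE => /andP[/eqP xt /eqP xat].
  have nz (y : F) : y ^+ t = 1 -> y != 0.
    by move=> yt; apply/eqP => y0; move: yt; rewrite y0 expr0n gtn_eqF// => /esym/eqP;
      rewrite oner_eq0.
  apply: (@root_theta_order _ p D a x _ charF Dp (nz _ xt) _) => [|k kD].
    by rewrite -subr_eq0 nz.
  rewrite /root; apply/eqP; rewrite -[RHS](horner0 x) -[in RHS](Ef k kD).
  rewrite /Psi iter_theta_sum !horner_sum; apply: eq_bigr => i _.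
  rewrite iter_theta_sum !horner_sum; apply: eq_bigr => j _.
  rewrite iter_theta_monomial !hornerE /= !exprM xt xat.
  by rewrite !expr1n !mulr1.
have := size_exp (\prod_(x <- enum Z) ('X - x%:P)) D.
rewrite size_prod_XsubC /= -cardE => <-.
apply: leq_trans (leq_pred _) _; apply: leq_trans sPsi.
exact: dvdp_leq.
Qed.

Lemma root_nat_exists (k t : nat) : (0 < k)%N ->
  exists2 B : nat, (B ^ k <= t)%N & (t < B.+1 ^ k)%N.
Proof.
move=> k0; elim: t => [|t [B Bt tB]]; first by exists 0%N; rewrite ?exp0n ?exp1n.
have [le|lt] := leqP (B.+1 ^ k) t.+1; last by exists B => //; exact: ltnW.
exists B.+1 => //; apply: leq_ltn_trans tB _; rewrite ltn_exp2r//.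
Qed.

Lemma card_expr_eq1 (F : finFieldType) (t : nat) : (0 < t)%N ->
  (#|[set x : F | (x ^+ t == 1)%R]| <= t)%N.
Proof.
move=> t0; rewrite cardE; apply: max_unity_roots => //; last exact: enum_uniq.
by apply/allP => x; rewrite mem_enum inE unity_rootE.
Qed.

(* Parameters A = B^2 and D = B^2/2 with B the integer cube root of t. *)
Lemma stepanov_shift (F : finFieldType) (p t : nat) (a : F) :
  p \in [pchar F] -> a != 0 -> (0 < t)%N -> (t ^ 4 <= p ^ 3)%N ->
  (#|[set x : F | ((x ^+ t == 1) && ((x - a) ^+ t == 1))%R]| ^ 3 <= 4096 * t ^ 2)%N.
Proof.
move=> charF a0 t0 tp; set Z := [set x | _].
have Zt : (#|Z| <= t)%N.
  apply: leq_trans (card_expr_eq1 F t0); apply/subset_leq_card/fintype.subsetP => x.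
  by rewrite !inE => /andP[].
have [B Bt tB] := @root_nat_exists 3 t isT.
have p0 : (0 < p)%N by case: p tp {charF} => //; nia.
(* For B <= 1 one has t < 8, and the trivial bound t on the count suffices. *)
have [B1|B2] := leqP B 1.
  have t8 : (t < 8)%N by apply: leq_trans tB _; rewrite (leq_exp2r _ 2).
  by nia.
have tBp : (t * B <= p)%N.
  rewrite -(leq_exp2r _ _ (isT : (0 < 3)%N)) expnMn; apply: leq_trans tp.
  by rewrite (expnSr t 3) leq_mul2l Bt orbT.
pose D := (B ^ 2 %/ 2)%N.
have [D1 D2] : (2 * D <= B ^ 2)%N /\ (B ^ 2 <= 4 * D)%N by rewrite /D; nia.
have Bt' : (B ^ 2 * B <= t)%N by rewrite -expnSr.
have count : (#|Z| * D <= 2 * t * B)%N.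
  apply: (@stepanov_count F p (B ^ 2)) => //; nia.
have ZB : (#|Z| * B <= 8 * t)%N by nia.
(* The constant is 4096 = 8^3 * 8: the cube of #|Z| B <= 8 t is combined with t < (B + 1)^3 <= 8
   B^3. *)
have ZB3 : (#|Z| ^ 3 * B ^ 3 <= 512 * t ^ 3)%N.
  by rewrite -expnMn -[512%N]/(8 ^ 3)%N -expnMn leq_exp2r.
have tB3 : (t <= 8 * B ^ 3)%N.
  apply: leq_trans (ltnW tB) _; rewrite -[8%N]/(2 ^ 3)%N -expnMn leq_exp2r//; lia.
rewrite -(leq_pmul2l t0).
apply: leq_trans (leq_mul tB3 (leqnn _)) _.
by rewrite -mulnA [(B ^ 3 * _)%N]mulnC; move: ZB3; rewrite expnS; lia.
Qed.

(** * Zeros of sparse polynomials *)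

Lemma expf_card1 (F : finFieldType) (x : F) : x != 0 -> x ^+ #|F|.-1 = 1.
Proof.
move=> x0; apply: (mulfI x0); rewrite mulr1 -exprS prednK ?expf_card//.
by apply/card_gt0P; exists 0.
Qed.

Lemma card_roots (F : finFieldType) (P : {poly F}) :
  P != 0 -> (#|[set x | root P x]| < size P)%N.
Proof.
move=> P0; rewrite cardE; apply: max_poly_roots => //; last exact: enum_uniq.
by apply/allP => x; rewrite mem_enum inE.
Qed.

(* Averaging over v makes every substitution x = v u^k usable, whether or not k
   is coprime to #|F| - 1. *)
Lemma card_zeros_average (F : finFieldType) (Z : {set F}) (k R : nat) :
  0 \notin Z ->
  (forall v : F, v != 0%R -> #|[set u | ((u != 0) && (v * u ^+ k \in Z))%R]| <= R)%N ->
  (#|Z| <= R)%N.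
Proof.
move=> Z0 ZR; have q0 : (0 < #|F|.-1)%N by rewrite -subn1 subn_gt0 card_finNzRing_gt1.
have cnz : #|[pred x : F | x != 0]| = #|F|.-1 by rewrite -(cardC1 (0 : F)).
rewrite -(leq_pmul2l q0).
(* Count the pairs (u, v) with u != 0 and v u^k in Z: for fixed u, v |-> v u^k is a bijection. *)
have -> : (#|F|.-1 * #|Z| =
    \sum_(u : F | u != 0%R) \sum_(v : F) (v * u ^+ k \in Z)%R)%N.
  rewrite -cnz -sum_nat_const; apply: eq_bigr => u u0.
  rewrite -sum1_card big_mkcond /= (reindex_inj (mulIf (expf_neq0 k u0))).
  by apply: eq_bigr => v _; case: (_ \in Z).
rewrite exchange_big (bigD1 0)//= big1 ?add0n => [|u _]; last first.
  by rewrite mul0r (negPf Z0).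
rewrite -cnz -sum_nat_const; apply: leq_sum => v v0.
apply: leq_trans (ZR v v0); rewrite -sum1_card big_mkcond /= [leqRHS]big_mkcond.
by apply: leq_sum => u _; rewrite inE; case: (u != 0); case: (_ \in Z).
Qed.

(* By Dirichlet's theorem some k < G makes all k (n j - n i0) close to 0 modulo
   #|F| - 1, so that substituting v x^k yields polynomials of small degree. *)
Lemma card_sparse_zeros (F : finFieldType) (nu : nat) (a : 'I_nu.+1 -> F)
    (n : 'I_nu.+1 -> nat) (i0 : 'I_nu.+1) (Q G : nat) :
  a i0 != 0 -> (0 < Q)%N -> (Q ^ nu < G)%N ->
  (forall j k, j != i0 -> (0 < k < G)%N ->
    ~~ (#|F|.-1 %| k * `|n j - n i0|)%N) ->
  (#|[set x | ((x != 0) && (\sum_i a i * x ^+ n i == 0))%R]| * Q <= 2 * #|F|.-1)%N.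
Proof.
move=> ai0 Q0 QG ndvd; set Z := [set x | _]; set q := #|F|.-1 in ndvd *.
have q0 : (0 < q)%N by rewrite /q -subn1 subn_gt0 card_finNzRing_gt1.
(* A natural number congruent to n_j - n_i0 modulo q. *)
pose m j := (n j + q.-1 * n i0)%N.
pose rho k j := (k * m j %% q)%N.
have rq k j : (rho k j < q)%N by rewrite ltn_mod.
have rho0 k : rho k i0 = 0%N.
  by rewrite /rho /m; apply/eqP; apply/dvdnP; exists (k * n i0)%N;
    rewrite -mulSn prednK//; lia.
case: Q Q0 QG => // Q _ QG.
(* Dirichlet's pigeonhole: cut [0, q) into [Q.+1] equal intervals and record those containing the
   residues of k m_j. The index i0, whose residue is always 0, is omitted, so nu coordinates
   suffice. *)
pose box (k : 'I_G) : {ffun 'I_nu -> 'I_Q.+1} :=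
  [ffun j => inord (rho k (lift i0 j) * Q.+1 %/ q)].
have [k1 [k2 [k12 k2G bk]]] : exists k1 k2 : nat, [/\ (k1 < k2)%N, (k2 < G)%N &
    forall j, (rho k1 j * Q.+1 %/ q = rho k2 j * Q.+1 %/ q)%N].
  have /injectivePn[k1 [k2 k12 bk]] : ~~ injectiveb box.
    apply/negP => /injectiveP /leq_card; rewrite card_ffun !card_ord.
    by rewrite leqNgt QG.
  have E j : (rho k1 j * Q.+1 %/ q = rho k2 j * Q.+1 %/ q)%N.
    case: (unliftP i0 j) => [{}j ->|->]; last by rewrite !rho0.
    move/ffunP: bk => /(_ j); rewrite !ffunE => /(congr1 val) /=.
    by rewrite !inordK// ltn_divLR// mulnC ltn_pmul2l.
  have [lt|lt|e] := ltngtP k1 k2.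
  - by exists k1, k2; split.
  - by exists k2, k1; split.
  - by case/eqP: k12; exact/val_inj.
pose k := (k2 - k1)%N; pose R := (q %/ Q.+1)%N.
have bnd j : (rho k1 j <= R + rho k2 j)%N /\ (rho k2 j <= R + rho k1 j)%N.
  suff H x y : (x * Q.+1 %/ q = y * Q.+1 %/ q)%N -> (x <= R + y)%N.
    by split; apply: H.
  move=> e; rewrite /R addnC -leq_subLR leq_divRL// mulnBl.
  have := divn_eq (x * Q.+1) q; have := divn_eq (y * Q.+1) q.
  by rewrite e; have := ltn_pmod (x * Q.+1) q0; lia.
(* The small residue of k m_j, possibly negative, is shifted by R to lie in [0, 2 R]. *)
pose s j := (R + rho k2 j - rho k1 j)%N.
have si0 : s i0 = R by rewrite /s !rho0 subn0 addn0.
have sj j : j != i0 -> s j != R.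
  move=> ji0; apply: contra (ndvd j k ji0 _) => [/eqP e|]; last by rewrite /k; lia.
  have {e} : rho k1 j = rho k2 j by have [] := bnd j; move: e; rewrite /s; lia.
  move/esym/eqP; rewrite /rho eqn_mod_dvd ?leq_mul2r ?(ltnW k12) ?orbT// -mulnBl -/k.
  case/dvdnP => c ec; suff : (q%:Z %| k%:Z * ((n j)%:Z - (n i0)%:Z))%Z.
    by rewrite dvdzE abszM !absz_nat.
  apply/dvdzP; exists (c%:Z - k%:Z * (n i0)%:Z).
  have -> : (n j)%:Z = (m j)%:Z - q.-1%:Z * (n i0)%:Z by rewrite /m; lia.
  by nia.
(* At u != 0, with y = v u^k != 0, this is u^R y^(-n_i0) times the sparse polynomial at y. It is
   nonzero because only the index i0 contributes to X^R. *)
pose P v : {poly F} := \sum_j (a j * v ^+ m j) *: 'X^(s j).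
have P0 v : v != 0 -> P v != 0.
  move=> v0; apply/eqP => /polyP/(_ R)/eqP; rewrite coef0 coef_sum (bigD1 i0)//=.
  rewrite big1 => [|j ji0]; last first.
    by rewrite coefZ coefXn eq_sym (negPf (sj j ji0)) mulr0.
  by rewrite coefZ coefXn si0 eqxx mulr1 addr0 mulf_eq0 expf_eq0 (negPf ai0) (negPf v0) andbF.
have sP v : (size (P v) <= (2 * R).+1)%N.
  apply: size_sum_leq => j; apply: leq_trans (size_scale_leq _ _) _.
  by rewrite size_polyXn ltnS /s; have [] := bnd j; lia.
have rootP v u : u != 0 -> v * u ^+ k \in Z -> root (P v) u.
  move=> u0; rewrite inE => /andP[vu0 /eqP fz]; rewrite /root horner_sum.
  have uq : u ^+ q = 1 by exact: expf_card1.
  have ur l j : u ^+ rho l j = u ^+ (l * m j) by rewrite /rho expr_mod.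
  have us j : u ^+ s j = u ^+ R * u ^+ (k * m j).
    apply: (mulIf (expf_neq0 (rho k1 j) u0)).
    rewrite -[LHS]exprD /s subnK; last by have [] := bnd j.
    by rewrite exprD !ur -mulrA; congr (_ * _); rewrite -exprD -mulnDl subnK// ltnW.
  set y := v * u ^+ k in vu0 fz *.
  have yq : y ^+ q = 1 by exact: expf_card1.
  rewrite (eq_bigr (fun j => u ^+ R * (a j * y ^+ m j))); last first.
    move=> j _; rewrite hornerZ hornerXn us /y exprMn -exprM; ring.
  rewrite -mulr_sumr mulf_eq0; apply/orP; right.
  apply/eqP/(mulIf (expf_neq0 (n i0) vu0)); rewrite mul0r -[RHS]fz mulr_suml.
  apply: eq_bigr => j _; rewrite -mulrA -exprD /m -addnA -mulSnr prednK//.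
  by rewrite exprD exprM yq expr1n mulr1.
have ZR : (#|Z| <= 2 * R)%N.
  apply: (@card_zeros_average _ _ k) => [|v v0]; first by rewrite inE eqxx.
  rewrite -ltnS; apply: leq_trans (sP v); apply: leq_ltn_trans (card_roots (P0 v v0)).
  apply/subset_leq_card/fintype.subsetP => u; rewrite inE => /andP[u0 uZ].
  by rewrite inE; exact: rootP.
apply: leq_trans (leq_mul ZR (leqnn _)) _; rewrite -mulnA leq_mul2l /=.
exact: leq_trunc_div.
Qed.

(** * Gauss sums over a subgroup of a finite field *)

Definition is_addchar (F : finFieldType) (R : rcfType) (psi : F -> R[i]) : Prop :=
  [/\ psi 0 = 1, forall x y, psi (x + y) = psi x * psi y,
      forall x, (psi x)^*%C = psi (- x) & exists x, psi x != 1].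

Definition gauss (F : finFieldType) (R : rcfType) (psi : F -> R[i])
    (H : {set F})
    (c : F) : R[i] := \sum_(h in H) psi (c * h).

Definition unity_roots (F : finFieldType) (t : nat) : {set F} := [set x | x ^+ t == 1].

Lemma sum_unity_roots_mul (F : finFieldType) (V : nmodType) (t : nat) (h : F) (f : F -> V) :
  (0 < t)%N -> h \in unity_roots F t ->
  \sum_(x in unity_roots F t) f (h * x) = \sum_(x in unity_roots F t) f x.
Proof.
move=> t0; rewrite inE => /eqP ht.
have h0 : h != 0.
  by apply/eqP => h0; move: ht => /eqP; rewrite h0 expr0n gtn_eqF// eq_sym oner_eq0.
rewrite [RHS](reindex_inj (mulfI h0)); apply: eq_bigl => x.
by rewrite !inE exprMn ht mul1r.
Qed.

Lemma ler_normc_sum (R : rcfType) (I : finType) (P : pred I) (f : I -> R[i]) :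
  normc (\sum_(i | P i) f i) <= \sum_(i | P i) normc (f i).
Proof.
elim/big_ind2 : _ => [|x a y b xa yb|//]; first by rewrite normc0.
by apply: le_trans (le_normcD _ _) _; exact: lerD.
Qed.

Lemma normc_nat (R : rcfType) (n : nat) : normc (n%:R : R[i]) = n%:R.
Proof. by rewrite normcMn normc1. Qed.

Lemma normc_ge0 (R : rcfType) (z : R[i]) : 0 <= normc z.
Proof. by case: z => a b; exact: sqrtr_ge0. Qed.

Lemma sqr_normcE (R : rcfType) (z : R[i]) : (normc z ^+ 2)%:C%C = z * z^*%C.
Proof. by rewrite -sqr_normc rmorphXn. Qed.

(** By Lagrange's identity, twice the difference of the two sides is a sum of squares. *)
Lemma Cauchy_Schwarz_sum (R : rcfType) (I : finType) (P : pred I) (a b : I -> R) :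
  (\sum_(i | P i) a i * b i) ^+ 2 <=
  (\sum_(i | P i) a i ^+ 2) * (\sum_(i | P i) b i ^+ 2).
Proof.
rewrite -subr_ge0 -(pmulr_lge0 _ (ltr0Sn R 1)).
have -> : ((\sum_(i | P i) a i ^+ 2) * (\sum_(i | P i) b i ^+ 2) -
   (\sum_(i | P i) a i * b i) ^+ 2) * 2 =
   \sum_(i | P i) \sum_(j | P j) (a i * b j - a j * b i) ^+ 2.
  set A := \sum_(i | P i) a i ^+ 2; set B := \sum_(i | P i) b i ^+ 2.
  set C := \sum_(i | P i) a i * b i.
  transitivity (\sum_(i | P i) (a i ^+ 2 * B + b i ^+ 2 * A - (a i * b i) * (2 * C))).
    by rewrite !(sumrB, big_split) /= -!mulr_suml -/A -/B -/C; ring.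
  apply: eq_bigr => i _; rewrite !mulr_sumr -!big_split /= -sumrB.
  by apply: eq_bigr => j _; ring.
by apply: sumr_ge0 => i _; apply: sumr_ge0 => j _; exact: sqr_ge0.
Qed.

Lemma addchar_orth (F : finFieldType) (R : rcfType) (psi : F -> R[i]) (c : F) :
  is_addchar psi ->
  \sum_(x : F) psi (x * c) = if c == 0 then #|F|%:R else 0.
Proof.
move=> [psi0 psiD _ [x0 psi_x0]]; case: eqVneq => [->|c0].
  by under eq_bigr do rewrite mulr0 psi0; rewrite sumr_const.
have -> : \sum_x psi (x * c) = \sum_x psi x by rewrite [RHS](reindex_inj (mulIf c0)).
set S := \sum_x psi x; have /eqP : (psi x0 - 1) * S = 0.
  rewrite mulrBl mul1r {1}/S mulr_sumr; apply/eqP; rewrite subr_eq0; apply/eqP.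
  by rewrite [RHS](reindex_inj (addrI x0)); apply: eq_bigr => x _; rewrite psiD.
by rewrite mulf_eq0 subr_eq0 (negPf psi_x0) => /eqP.
Qed.

Lemma gauss_conj (F : finFieldType) (R : rcfType) (psi : F -> R[i])
    (H : {set F}) (c : F) :
  is_addchar psi ->
  gauss psi H c * (gauss psi H c)^*%C =
  \sum_(h in H) \sum_(k in H) psi (c * (h - k)).
Proof.
move=> [_ psiD psiN _]; rewrite /gauss mulr_suml; apply: eq_bigr => h _.
rewrite rmorph_sum mulr_sumr; apply: eq_bigr => k _.
by rewrite /= psiN -psiD mulrBr.
Qed.

Lemma gauss_parseval (F : finFieldType) (R : rcfType) (psi : F -> R[i])
    (H : {set F}) :
  is_addchar psi ->
  \sum_c normc (gauss psi H c) ^+ 2 = #|F|%:R * #|H|%:R.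
Proof.
move=> psiP; apply: (@complexI R); rewrite rmorph_sum rmorphM !rmorph_nat /=.
under eq_bigr do rewrite sqr_normcE gauss_conj//.
rewrite exchange_big /= mulr_natr -sumr_const; apply: eq_bigr => h hH.
rewrite exchange_big (bigD1 h)//= addchar_orth// subrr eqxx big1 ?addr0//.
move=> k /andP[_ kh]; rewrite addchar_orth// subr_eq0 eq_sym (negPf kh)//.
Qed.

Lemma gauss_mul_unity_root (F : finFieldType) (R : rcfType) (psi : F -> R[i])
    (t : nat) (c h : F) :
  (0 < t)%N -> h \in unity_roots F t ->
  gauss psi (unity_roots F t) (c * h) =
  gauss psi (unity_roots F t) c.
Proof.
move=> t0 hH; rewrite /gauss -(@sum_unity_roots_mul _ _ t h (fun x => psi (c * x)))//.
by apply: eq_bigr => x _; rewrite mulrA.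
Qed.

(** Its cardinality is the number of representations x = h - k with h, k in H. For roots of unity it
    is what Stepanov's method bounds. *)
Definition shifts (F : finFieldType) (H : {set F}) (x : F) : {set F} :=
  [set h in H | h - x \in H].

Lemma sum_shifts (F : finFieldType) (V : nmodType) (H : {set F}) (f : F -> V) :
  \sum_(h in H) \sum_(k in H) f (h - k) = \sum_x f x *+ #|shifts H x|.
Proof.
rewrite (eq_bigr (fun h => \sum_(x | h - x \in H) f x)) => [|h _].
  rewrite (exchange_big_dep xpredT)//=; apply: eq_bigr => x _.
  by rewrite sumr_const; congr (_ *+ _); apply: eq_card => h; rewrite !inE.
have inj : injective (fun x => h - x) by move=> x y /addrI /oppr_inj.
rewrite [RHS](reindex_inj inj) /=; apply: eq_bigl => x.
by rewrite subKr.
Qed.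

(* Averaging over H: #|H| |K(c)|^2 = \sum_x #|shifts H x| K(c x). *)
Lemma gauss_average (F : finFieldType) (R : rcfType) (psi : F -> R[i])
    (t : nat) (c : F) :
  is_addchar psi -> (0 < t)%N ->
  #|unity_roots F t|%:R * normc (gauss psi (unity_roots F t) c) ^+ 2 <=
  #|unity_roots F t|%:R ^+ 2 +
    \sum_(x | x != 0) #|shifts (unity_roots F t) x|%:R *
      normc (gauss psi (unity_roots F t) (c * x)).
Proof.
move=> psiP t0; set H := unity_roots F t.
have E : #|H|%:R * (gauss psi H c * (gauss psi H c)^*%C) =
    \sum_x gauss psi H (c * x) *+ #|shifts H x|.
  rewrite -sum_shifts mulr_natl -sumr_const.
  under eq_bigr => h hH do rewrite -(gauss_mul_unity_root psi c t0 hH) gauss_conj//.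
  rewrite exchange_big /=; apply: eq_bigr => h _.
  rewrite exchange_big /=; apply: eq_bigr => k _.
  by apply: eq_bigr => l _; rewrite mulrAC.
have -> : #|H|%:R * normc (gauss psi H c) ^+ 2 =
    normc (#|H|%:R * (gauss psi H c * (gauss psi H c)^*%C)).
  rewrite -sqr_normcE !normcM normc_nat; congr (_ * _).
  by rewrite /= expr0n /= addr0 sqrtr_sqr ger0_norm// sqr_ge0.
rewrite E; apply: le_trans (ler_normc_sum _ _) _.
rewrite (bigD1 0)//= lerD//; last first.
  by apply: ler_sum => x _; rewrite normcMn mulr_natl.
rewrite normcMn mulr0 -[leLHS]mulr_natr expr2 ler_pM ?ler0n ?normc_ge0//.
  rewrite /gauss; under eq_bigr do rewrite mul0r.
  have [-> _ _ _] := psiP.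
  by rewrite sumr_const normc_nat.
by rewrite ler_nat subset_leq_card//; apply/fintype.subsetP => x; rewrite inE => /andP[].
Qed.

(** Cauchy-Schwarz is applied to the sum in [gauss_average]. With T = #|H|, the counts
    [#|shifts H x|] are at most rho and add up to T^2, so their squares sum to at most rho T^2.
    Parseval bounds the other factor by #|F| T. *)
Lemma gauss_bound (F : finFieldType) (R : rcfType) (psi : F -> R[i])
    (t : nat) (c : F)
    (rho : R) :
  is_addchar psi -> (0 < t)%N -> c != 0 ->
  (forall x, x != 0 -> #|shifts (unity_roots F t) x|%:R <= rho) ->
  normc (gauss psi (unity_roots F t) c) ^+ 2 <=
  #|unity_roots F t|%:R + Num.sqrt (rho * #|F|%:R * #|unity_roots F t|%:R).
Proof.
move=> psiP t0 c0; set H := unity_roots F t; move=> Hrho; pose T : R := #|H|%:R; rewrite -/T.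
have T0 : 0 < T.
  by rewrite ltr0n; apply/card_gt0P; exists 1; rewrite inE expr1n.
have CS := Cauchy_Schwarz_sum (fun x => x != 0) (fun x => #|shifts H x|%:R)
  (fun x => normc (gauss psi H (c * x))).
have A := gauss_average c psiP t0; rewrite /= -/H -/T in A.
set S := \sum_(x | _) _ in A CS.
have S0 : 0 <= S by apply: sumr_ge0 => x _; rewrite mulr_ge0 ?ler0n ?normc_ge0.
have S2 : S ^+ 2 <= T ^+ 2 * (rho * #|F|%:R * T).
  apply: le_trans CS _.
  have -> : T ^+ 2 * (rho * #|F|%:R * T) = (rho * T ^+ 2) * (#|F|%:R * T) by ring.
  apply: ler_pM; try by apply: sumr_ge0 => x _; exact: sqr_ge0.
    have -> : T ^+ 2 = \sum_x #|shifts H x|%:R.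
      have := sum_shifts H (fun _ : F => 1 : R).
      by rewrite !sumr_const -mulrnA expr2 -natrM => ->.
    rewrite mulr_sumr [leRHS](bigD1 0)//= -[leLHS]add0r lerD//; last first.
      by apply: ler_sum => x x0; rewrite expr2 ler_wpM2r ?ler0n ?Hrho.
    by rewrite mulr_ge0 ?ler0n// (le_trans (ler0n _ _) (Hrho 1 (oner_neq0 _))).
  rewrite -(gauss_parseval H psiP) [leRHS](reindex_inj (mulfI c0)) /=.
  by rewrite [leRHS](bigD1 0)//= lerDr sqr_ge0.
rewrite -lerBlDl.
have {A} : T * (normc (gauss psi H c) ^+ 2 - T) <= S by nra.
move=> A; rewrite -(ler_pM2l T0); apply: le_trans A _.
rewrite -[leLHS](ger0_norm S0) -sqrtr_sqr.
apply: le_trans (ler_wsqrtr S2) _.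
by rewrite sqrtrM ?sqr_ge0// sqrtr_sqr gtr0_norm.
Qed.

(* [hf] says that multiplying f by h in H permutes its values, so the sum over x
   is an average of Gauss sums over H. *)
Lemma sum_addchar_le (F : finFieldType) (R : rcfType) (psi : F -> R[i])
    (H : {set F}) (f : F -> F) (k : R) :
  is_addchar psi -> 0 <= k -> (0 < #|H|)%N ->
  (forall h, h \in H -> \sum_x psi (h * f x) = \sum_x psi (f x)) ->
  (forall c, c != 0 -> normc (gauss psi H c) <= k) ->
  normc (\sum_x psi (f x)) <=
  #|[set x | f x == 0]|%:R + #|F|%:R / #|H|%:R * k.
Proof.
move=> psiP k0 H0 hf Hk; set Z := [set x | _].
have T0 : 0 < #|H|%:R :> R by rewrite ltr0n.
rewrite -(ler_pM2l T0).
have -> : #|H|%:R * (#|Z|%:R + #|F|%:R / #|H|%:R * k) =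
  #|H|%:R * #|Z|%:R + #|F|%:R * k by field; rewrite gt_eqF.
have -> : #|H|%:R * normc (\sum_x psi (f x)) = normc (\sum_x gauss psi H (f x)).
  rewrite -normc_nat -normcM mulr_natl -sumr_const; congr normc.
  under eq_bigr => h hH do rewrite -(hf h hH).
  rewrite exchange_big; apply: eq_bigr => x _.
  by apply: eq_bigr => h _; rewrite mulrC.
apply: le_trans (ler_normc_sum _ _) _; rewrite (bigID (mem Z)) /=; apply: lerD.
  rewrite mulr_natr -sumr_const; apply: ler_sum => x; rewrite inE => /eqP ->.
  rewrite /gauss; under eq_bigr do rewrite mul0r.
  by have [-> _ _ _] := psiP; rewrite sumr_const normc_nat.
apply: (@le_trans _ _ (\sum_(x | x \notin Z) k)).
  by apply: ler_sum => x; rewrite inE; exact: Hk.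
rewrite sumr_const -[leLHS]mulr_natl ler_wpM2r// ler_nat max_card//.
Qed.

(** * The additive character of F_p *)

Lemma epD (R : realType) (p : nat) (x y : int) : ep R p (x + y) = ep R p x * ep R p y.
Proof.
rewrite /ep rmorphD /= mulrDr mulrDl cosD sinD.
by apply/eqP; rewrite eq_complex /= eqxx /= addrC mulrC [X in _ + X]mulrC.
Qed.

Lemma epN (R : realType) (p : nat) (x : int) : ep R p (- x) = (ep R p x)^*%C.
Proof. by rewrite /ep rmorphN /= mulrN mulNr cosN sinN. Qed.

Lemma ep0 (R : realType) (p : nat) : ep R p 0 = 1.
Proof. by rewrite /ep rmorph0 mulr0 mul0r cos0 sin0. Qed.

Lemma ep1_neq1 (R : realType) (p : nat) : (1 < p)%N -> ep R p 1 != 1.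
Proof.
move=> p1; have P2 : 2 <= p%:R :> R by rewrite ler_nat.
have P0 : 0 < p%:R :> R by rewrite (lt_le_trans _ P2).
pose t : R := 2 * pi * (1 : int)%:~R / p%:R.
have t0 : 0 < t by rewrite divr_gt0// !mulr_gt0 ?pi_gt0.
(* As p >= 2, the angle lies in (0, pi], where the cosine is injective and so differs from cos 0. *)
have tpi : t <= pi by rewrite ler_pdivrMr// mulr1 mulrC ler_wpM2l ?pi_ge0.
apply/eqP; rewrite /ep -/t => /(congr1 (@complex.Re R)) /=; rewrite -cos0 => ct.
have := @cos_inj R t 0; rewrite !in_itv/= lexx pi_ge0 tpi ltW// => /(_ isT isT ct) t00.
by rewrite t00 ltxx in t0.
Qed.

Lemma Fp_intr_eq0 (p : nat) (z : int) : prime p -> (z%:~R == 0 :> 'F_p) = (p %| z)%Z.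
Proof.
move=> pr; have ch := pchar_Fp pr; rewrite dvdzE absz_nat (dvdn_pcharf ch).
by case: z => n; rewrite ?NegzE ?rmorphN ?oppr_eq0 ?abszN.
Qed.

Definition Fp_char (R : realType) (p : nat) (x : 'F_p) : R[i] := ep R p (x : nat)%:Z.

Lemma Fp_char_intr (R : realType) (p : nat) (z : int) :
  prime p -> Fp_char R (z%:~R : 'F_p) = ep R p z.
Proof.
move=> pr; apply: ep_eqmod; first exact: prime_gt0.
apply/eqP; rewrite eqz_mod_dvd -Fp_intr_eq0// rmorphB /= subr_eq0.
by apply/eqP; exact: natr_Zp.
Qed.

Lemma Fp_char_addchar (R : realType) (p : nat) :
  prime p -> is_addchar (@Fp_char R p).
Proof.
move=> pr; have E x : x = ((x : nat)%:Z)%:~R :> 'F_p by exact/esym/natr_Zp.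
split.
- by rewrite /Fp_char ep0.
- by move=> x y; rewrite (E x) (E y) -rmorphD !Fp_char_intr// epD.
- by move=> x; rewrite (E x) -rmorphN !Fp_char_intr// epN.
- by exists (1%:~R); rewrite Fp_char_intr// ep1_neq1// prime_gt1.
Qed.

Lemma expsumE (R : realType) (p nu : nat) (n : 'I_nu.+1 -> nat) (a : 'I_nu.+1 -> int) :
  prime p ->
  expsum R p n a =
  \sum_(x : 'F_p) Fp_char R (\sum_i (a i)%:~R * x ^+ n i).
Proof.
move=> pr.
pose g k : R[i] := ep R p (\sum_(i < nu.+1) a i * k%:Z ^+ n i).
transitivity (\sum_(x : 'F_p) g x).
  rewrite /expsum -(big_mkord xpredT g) -[in RHS](big_mkord xpredT g).
  by rewrite (Fp_cast pr).
apply: eq_bigr => x _; rewrite /g -Fp_char_intr//; congr Fp_char.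
rewrite rmorph_sum; apply: eq_bigr => i _ /=.
by rewrite rmorphM rmorphXn /=; congr (_ * _ ^+ _); exact: natr_Zp.
Qed.

(** * Roots of unity in a finite field *)

Lemma finField_prim_root (F : finFieldType) (d : nat) : (d %| #|F|.-1)%N ->
  exists z : F, d.-primitive_root z.
Proof.
have q0 : (0 < #|F|.-1)%N by rewrite -subn1 subn_gt0 card_finNzRing_gt1.
move=> dq.
have /hasP[z _ zP] : has (#|F|.-1).-primitive_root (enum [pred x : F | x != 0]).
  apply: has_prim_root => //; last 2 first.
  - exact: enum_uniq.
  - by rewrite -cardE -(cardC1 (0 : F)).
  by apply/allP => x; rewrite mem_enum inE unity_rootE => /expf_card1 ->.
exists (z ^+ (#|F|.-1 %/ d)); exact: dvdn_prim_root.
Qed.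

Lemma card_unity_roots (F : finFieldType) (d : nat) : (d %| #|F|.-1)%N -> #|unity_roots F d| = d.
Proof.
move=> dq; have q0 : (0 < #|F|.-1)%N by rewrite -subn1 subn_gt0 card_finNzRing_gt1.
have d0 : (0 < d)%N by exact: dvdn_gt0 dq.
have [z zP] := finField_prim_root dq.
apply/eqP; rewrite eqn_leq card_expr_eq1//=.
pose g (i : 'I_d) := z ^+ i.
have gi : injective g.
  by move=> i j /eqP; rewrite /g (eq_prim_root_expr zP) !modn_small// => /eqP/val_inj.
rewrite -[X in (X <= _)%N]card_ord -(card_codom gi); apply/subset_leq_card/fintype.subsetP.
by move=> _ /codomP[i ->]; rewrite inE /g -exprM mulnC exprM (prim_expr_order zP) expr1n.
Qed.

(** For a primitive d-th root z, the power z^m is a primitive root of order d / gcd(d, m), so its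
    powers exhaust the roots of that order. With m = n_0 this order is Delta. *)
Lemma unity_root_expn (F : finFieldType) (d m : nat) (h : F) : (d %| #|F|.-1)%N ->
  h \in unity_roots F (d %/ gcdn d m) -> exists2 y, y ^+ d = 1 & h = y ^+ m.
Proof.
move=> dq; have [z zP] := finField_prim_root dq.
rewrite inE gcdnC => /eqP hP.
have [i ->] := prim_rootP (exp_prim_root zP m) hP.
by exists (z ^+ i); rewrite -?exprM mulnC// exprM (prim_expr_order zP) expr1n.
Qed.

(** * The parameters d, Delta, D and Gamma *)

Lemma dpar_dvd (p nu : nat) (n : 'I_nu.+1 -> nat) (i : 'I_nu.+1) :
  (dpar p n %| `|n i - n ord0|)%N.
Proof.
apply: dvdn_trans (dvdn_gcdl _ _) _; have [->|i0] := eqVneq i ord0.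
  by rewrite subrr dvdn0.
exact: (biggcdn_inf i).
Qed.

Lemma Dpar_attained (p nu : nat) (n : 'I_nu.+1 -> nat) :
  exists i, Dpar p n = maxgcd p n i.
Proof.
rewrite /Dpar; elim/big_ind : _ => [|x y [i ->] [j ->]|i _].
- by exists ord0.
- by rewrite /minn; case: ifP => _; [exists i|exists j].
- by exists i.
Qed.

Lemma Deltapar_dvd (p nu : nat) (n : 'I_nu.+1 -> nat) : (Deltapar p n %| p.-1)%N.
Proof.
apply: dvdn_trans (dvdn_gcdr _ _ : (dpar p n %| p.-1)%N).
by apply: dvdn_div; exact: dvdn_gcdl.
Qed.

Lemma Dpar_bounds (p nu : nat) (n : 'I_nu.+1 -> nat) : (1 < p)%N -> (0 < nu)%N ->
  (dpar p n <= Dpar p n <= p.-1)%N.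
Proof.
move=> p1 nu0; have [i ->] := Dpar_attained p n.
have q0 : (0 < p.-1)%N by lia.
have gp j : (0 < gcd_diff p n i j)%N by rewrite gcdn_gt0 q0 orbT.
have [j ji] : exists j : 'I_nu.+1, j != i.
  by case: nu nu0 n i {gp} => // nu _ n i; exists (lift i ord0); rewrite eq_sym neq_lift.
apply/andP; split; last first.
  by apply/bigmax_leqP => k _; apply: dvdn_leq => //; exact: dvdn_gcdr.
apply: (@leq_trans (gcd_diff p n i j)); last 
  exact: (@leq_bigmax_cond _ (fun j => j != i) (gcd_diff p n i) j ji).
apply: dvdn_leq => //.
rewrite dvdn_gcd [X in _ && X]dvdn_gcdr andbT.
have := dpar_dvd p n i; have := dpar_dvd p n j.
rewrite -!(dvdzE (dpar p n)%:Z) => dj di.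
have -> : (n j)%:Z - (n i)%:Z = ((n j)%:Z - (n ord0)%:Z) - ((n i)%:Z - (n ord0)%:Z) by ring.
by rewrite rpredB.
Qed.

(** This allows G = Gamma in [card_sparse_zeros]. Divisibility would pass to k gcd(n_j - n_i, p -
    1), giving p - 1 <= k D, whereas k < Gamma and Gamma D <= p - 1. *)
Lemma Gammapar_ndvd (p nu : nat) (n : 'I_nu.+1 -> nat) (i j : 'I_nu.+1) (k : nat) :
  (1 < p)%N -> Dpar p n = maxgcd p n i -> j != i -> (0 < k < Gammapar p n)%N ->
  ~~ (p.-1 %| k * `|n j - n i|)%N.
Proof.
move=> p1 Di ji /andP[k0 kG]; apply/negP => dvd.
have q0 : (0 < p.-1)%N by lia.
have gD : (gcd_diff p n i j <= Dpar p n)%N by rewrite Di; 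
  exact: (@leq_bigmax_cond _ (fun j => j != i) (gcd_diff p n i) j ji).
have : (p.-1 %| k * gcd_diff p n i j)%N by rewrite muln_gcdr dvdn_gcd dvd dvdn_mull.
have g0 : (0 < gcd_diff p n i j)%N by rewrite gcdn_gt0 q0 orbT.
move/dvdn_leq; rewrite muln_gt0 k0 g0 => /(_ isT).
have := leq_trunc_div p.-1 (Dpar p n); rewrite -/(Gammapar p n); nia.
Qed.

(** The product bound follows from Delta <= d <= D and Gamma D <= p - 1. *)
Lemma Delta_Gamma_le (p nu : nat) (n : 'I_nu.+1 -> nat) :
  (1 < p)%N -> (0 < nu)%N ->
  [/\ 0 < Deltapar p n, 0 < Gammapar p n & Deltapar p n * Gammapar p n <= p.-1]%N.
Proof.
move=> p1 nu0; have q0 : (0 < p.-1)%N by lia.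
have /andP[dD Dq] := Dpar_bounds n p1 nu0.
have Delta0 := dvdn_gt0 q0 (Deltapar_dvd p n).
have Dd : (Deltapar p n <= dpar p n)%N by exact: leq_div.
have D0 : (0 < Dpar p n)%N by lia.
split=> //; first by rewrite divn_gt0.
have := leq_trunc_div p.-1 (Dpar p n); rewrite -/(Gammapar p n); nia.
Qed.

Lemma sparse_sum_mul_unity_root (R : realType) (p nu : nat) (n : 'I_nu.+1 -> nat)
    (a : 'I_nu.+1 -> 'F_p) (h : 'F_p) :
  prime p -> h \in unity_roots 'F_p (Deltapar p n) ->
  \sum_(x : 'F_p) Fp_char R (h * \sum_i a i * x ^+ n i) =
  \sum_(x : 'F_p) Fp_char R (\sum_i a i * x ^+ n i).
Proof.
move=> pr hH.
have dq : (dpar p n %| #|'F_p|.-1)%N by rewrite card_Fp// dvdn_gcdr.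
have [y yd hy] := unity_root_expn dq hH.
have y0 : y != 0.
  have d0 : (0 < dpar p n)%N by rewrite gcdn_gt0 orbC -subn1 subn_gt0 prime_gt1.
  by apply/eqP => y0; move/eqP: yd; rewrite y0 expr0n gtn_eqF// eq_sym oner_eq0.
rewrite [RHS](reindex_inj (mulfI y0)); apply: eq_bigr => x _; congr Fp_char.
rewrite mulr_sumr; apply: eq_bigr => i _; rewrite mulrCA; congr (_ * _).
rewrite exprMn; congr (_ * _); rewrite hy.
(* Since d divides n_i - n_0 and y^d = 1, the powers y^(n_i) and y^(n_0) agree. *)
have /dvdnP[c ec] := dpar_dvd p n i.
have [le|/ltnW le] := leqP (n ord0) (n i).
  have -> : n i = (n ord0 + dpar p n * c)%N by lia.
  by rewrite exprD exprM yd expr1n mulr1.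
have -> : n ord0 = (n i + dpar p n * c)%N by lia.
by rewrite exprD exprM yd expr1n mulr1.
Qed.

(** * Bounds for the zeros, the Gauss sums and the maximum *)

Lemma normc_ep (R : realType) (p : nat) (z : int) : normc (ep R p z) = 1.
Proof. by rewrite /ep /= cos2Dsin2 sqrtr1. Qed.

Lemma normc_expsum_le (R : realType) (p nu : nat) (n : 'I_nu.+1 -> nat)
    (a : 'I_nu.+1 -> int) : normc (expsum R p n a) <= p%:R.
Proof.
apply: le_trans (ler_normc_sum _ _) _.
by under eq_bigr do rewrite normc_ep; rewrite sumr_const card_ord.
Qed.

Lemma card_sparse_zeros_le (R : realType) (p nu : nat) (n : 'I_nu.+1 -> nat)
    (a : 'I_nu.+1 -> 'F_p) :
  prime p -> (0 < nu)%N -> (forall i, a i != 0) ->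
  #|[set x | \sum_i a i * x ^+ n i == 0]|%:R <=
  5 * expR (ln p%:R - ln (Gammapar p n)%:R / nu%:R) :> R.
Proof.
move=> pr nu0 a0; have p1 := prime_gt1 pr.
have [Delta0 Gamma0 DG] := Delta_Gamma_le n p1 nu0.
set Z0 := [set x | _]; pose Z := [set x | (x != 0) && (\sum_i a i * x ^+ n i == 0)].
set g := ln (Gammapar p n)%:R / nu%:R.
have nuR : 1 <= nu%:R :> R by rewrite ler1n.
have p0 : 0 < p%:R :> R by rewrite ltr0n; lia.
have lnG : 0 <= ln (Gammapar p n)%:R :> R by rewrite ln_ge0 ?ler1n.
(* Gamma^(1/nu) <= p lets the possible zero x = 0 be absorbed, turning the constant 4 into 5. *)
have gp : expR g <= p%:R.
  rewrite -(@lnK _ p%:R) ?posrE// ler_expR /g ler_pdivrMr; last lra.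
  have : ln (Gammapar p n)%:R <= ln p%:R :> R.
    by rewrite ler_ln ?posrE ?ltr0n// ?ler_nat; nia.
  nra.
have ZZ : (#|Z0| <= #|Z| + 1)%N.
  rewrite addn1 -[#|Z|.+1]/(1 + #|Z|)%N.
  have -> : Z = Z0 :\ 0 by apply/setP => x; rewrite !inE.
  by rewrite (cardsD1 0 Z0) leq_add2r leq_b1.
suff NZ : #|Z|%:R * expR g <= 4 * p%:R.
  rewrite expRB lnK ?posrE// mulrA ler_pdivlMr ?expR_gt0//.
  have : #|Z0|%:R <= #|Z|%:R + 1 :> R by rewrite natr1 ler_nat -addn1.
  have := expR_gt0 g; nra.
have [G1|G2] := leqP (Gammapar p n) 1.
  have {}G1 : Gammapar p n = 1%N by lia.
  have -> : expR g = 1 by rewrite /g G1 ln1 mul0r expR0.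
  have : (#|Z| <= p)%N by rewrite -[leqRHS](card_Fp pr) max_card.
  by rewrite -(ler_nat R); lra.
(* Taking the root of Gamma - 1 gives the strict Q^nu < Gamma, and still Gamma <= (Q + 1)^nu, so
   Gamma^(1/nu) <= 2 Q. *)
have [Q QG GQ] := @root_nat_exists nu (Gammapar p n).-1 nu0.
have Q0 : (0 < Q)%N.
  by case: Q GQ {QG} => //; rewrite exp1n; lia.
have [i0 Di] := Dpar_attained p n.
have := @card_sparse_zeros 'F_p nu a n i0 Q (Gammapar p n) (a0 i0) Q0.
rewrite card_Fp// -/Z => /(_ _ _) ZQ.
have {}ZQ : (#|Z| * Q <= 2 * p.-1)%N.
  by apply: ZQ => [|j k ji kG]; [lia|exact: Gammapar_ndvd].
have gQ : expR g <= (2 * Q)%:R.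
  apply: (@le_trans _ _ (Q.+1)%:R); last by rewrite ler_nat; lia.
  rewrite -[leRHS]lnK ?posrE ?ltr0n// ler_expR /g ler_pdivrMr; last lra.
  rewrite mulr_natr -lnXn ?ltr0n// -natrX ler_ln ?posrE ?ltr0n// ?expn_gt0//.
  by rewrite ler_nat; lia.
have : (#|Z| * (2 * Q) <= 4 * p)%N by lia.
rewrite -(ler_nat R) !natrM; apply: le_trans; rewrite ler_wpM2l// -natrM//.
Qed.

Lemma gauss_unity_roots_le (R : realType) (p t : nat) (c : 'F_p) :
  prime p -> (t %| p.-1)%N -> (t ^ 4 <= p ^ 3)%N -> c != 0 ->
  normc (gauss (@Fp_char R p) (unity_roots 'F_p t) c) <=
  3 * expR (ln p%:R / 4 + 5 / 12 * ln t%:R).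
Proof.
move=> pr tq tp c0; have p1 := prime_gt1 pr.
have q0 : (0 < p.-1)%N by lia.
have t0 : (0 < t)%N by exact: dvdn_gt0 tq.
have tp' : (t <= p)%N by have := dvdn_leq q0 tq; lia.
have tR : 0 < t%:R :> R by rewrite ltr0n.
have pR : 0 < p%:R :> R by rewrite ltr0n; lia.
have cH : #|unity_roots 'F_p t| = t by rewrite card_unity_roots// card_Fp.
(* The cube root of 4096 t^2. *)
pose rho : R := 16 * expR (2 / 3 * ln t%:R).
have Hrho x : x != 0 -> #|shifts (unity_roots 'F_p t) x|%:R <= rho.
  move=> x0; rewrite -(ler_pXn2r (isT : (0 < 3)%N)) ?nnegrE ?ler0n//; last first.
    by rewrite mulr_ge0// expR_ge0.
  have -> : rho ^+ 3 = (4096 * t ^ 2)%:R.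
    rewrite /rho exprMn -expRM_natl natrM natrX -[in RHS](@lnK _ t%:R) ?posrE//.
    by rewrite -expRM_natl; congr (_ * expR _); [ring|field].
  rewrite -natrX ler_nat.
  have -> : shifts (unity_roots 'F_p t) x =
      [set h | (h ^+ t == 1) && ((h - x) ^+ t == 1)].
    by apply/setP => h; rewrite !inE.
  exact: (stepanov_shift (pchar_Fp pr)).
have := gauss_bound (Fp_char_addchar R pr) t0 c0 Hrho; rewrite cH card_Fp//.
set k := normc _; set x := ln p%:R; set d := ln t%:R.
have -> : rho * p%:R * t%:R = (4 * expR (x / 2 + 5 / 6 * d)) ^+ 2.
  rewrite /rho exprMn -expRM_natl -[in LHS](@lnK _ p%:R) ?posrE//.
  rewrite -[X in _ * X = _](@lnK _ t%:R) ?posrE// -/x -/d -mulrA -expRD -mulrA -expRD.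
  by congr (_ * expR _); [ring|field].
rewrite sqrtr_sqr ger0_norm; last by rewrite mulr_ge0// expR_ge0.
have d0 : 0 <= d by rewrite ln_ge0// ler1n.
have dx : d <= x by rewrite ler_ln ?posrE// ler_nat.
(* As t <= p, the diagonal term t is at most p^(1/2) t^(5/6); the square of the Gauss sum is then at
   most 5, hence 9, times this quantity. *)
have te : t%:R <= expR (x / 2 + 5 / 6 * d).
  rewrite -[leLHS]lnK ?posrE// ler_expR -/d; lra.
move=> k2.
have E0 := expR_ge0 (x / 4 + 5 / 12 * d).
rewrite -(ler_pXn2r (isT : (0 < 2)%N)) ?nnegrE ?normc_ge0 ?mulr_ge0//.
rewrite exprMn -expRM_natl.
have -> : 2 * (x / 4 + 5 / 12 * d) = x / 2 + 5 / 6 * d by field.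
have := expR_ge0 (x / 2 + 5 / 6 * d); lra.
Qed.

Lemma maxsum_le_card (R : realType) (p nu : nat) (n : 'I_nu.+1 -> nat) :
  (0 < p)%N -> maxsum R p n <= p%:R.
Proof. by move=> p0; have [a _ <-] := maxsum_attained R n p0; exact: normc_expsum_le. Qed.

Lemma maxsum_le (R : realType) (p nu : nat) (n : 'I_nu.+1 -> nat) :
  prime p -> (0 < nu)%N -> (Deltapar p n ^ 4 <= p ^ 3)%N ->
  maxsum R p n <= 5 * expR (ln p%:R - ln (Gammapar p n)%:R / nu%:R) +
    3 * expR (5 / 4 * ln p%:R - 7 / 12 * ln (Deltapar p n)%:R).
Proof.
move=> pr nu0 D4; set x := ln p%:R; set d := ln (Deltapar p n)%:R; have p1 := prime_gt1 pr.
have [Delta0 Gamma0 _] := Delta_Gamma_le n p1 nu0.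
have [a /= ap <-] := maxsum_attained R n (ltnW p1).
pose b i : 'F_p := (a i)%:~R.
(* The product of the a_i is coprime to p, so no a_i vanishes modulo p. *)
have b0 i : b i != 0.
  rewrite /b Fp_intr_eq0//; apply/negP => pa.
  have : (p %| \prod_i a i)%Z by rewrite (bigD1 i)//= dvdz_mulr.
  move=> pprod; have : (p %| gcdz (\prod_i a i) p)%Z by rewrite dvdz_gcd pprod dvdzz.
  by rewrite (eqP ap) dvdzE /= dvdn1; lia.
have cH : #|unity_roots 'F_p (Deltapar p n)| = Deltapar p n.
  by rewrite card_unity_roots// card_Fp// Deltapar_dvd.
rewrite expsumE//.
have := @sum_addchar_le 'F_p R (@Fp_char R p) (unity_roots 'F_p (Deltapar p n))
  (fun y => \sum_i b i * y ^+ n i) (3 * expR (x / 4 + 5 / 12 * d)) (Fp_char_addchar R pr).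
rewrite cH card_Fp// => /(_ _ Delta0) H; apply: le_trans (H _ _ _) _.
- by rewrite mulr_ge0// expR_ge0.
- by move=> h hH; exact: sparse_sum_mul_unity_root.
- by move=> c c0; apply: gauss_unity_roots_le => //; exact: Deltapar_dvd.
rewrite lerD ?card_sparse_zeros_le// mulrCA ler_wpM2l//.
have DR : 0 < (Deltapar p n)%:R :> R by rewrite ltr0n.
rewrite -[X in X / _]lnK ?posrE ?ltr0n; last lia.
rewrite -[X in _ / X]lnK ?posrE// -expRN -!expRD ler_expR -/x -/d; lra.
Qed.

(** * The o(1) factor and the comparison of exponents *)

Lemma cvg_div_ln (R : realType) (c : R) : (c / ln k%:R @[k --> \oo] --> (0 : R))%classic.
Proof.
rewrite -(mulr0 c); apply: cvgM; first exact: cvg_cst.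
apply/gtr0_cvgV0.
  near=> k; rewrite ln_gt0// ltr1n; near: k.
  by exists 2%N.
apply/cvgryPge => y; near=> k.
have yk : expR y <= k%:R by near: k; exact: nbhs_infty_ger.
by rewrite -ler_expR lnK// posrE (lt_le_trans (expR_gt0 y)).
Unshelve. all: by end_near.
Qed.

Lemma powR_expR (R : realType) (x y : R) : 0 < x -> x `^ y = expR (y * ln x).
Proof. by move=> x0; rewrite /powR gt_eqF. Qed.

Local Open Scope classical_set_scope.

Theorem theorem2p1 (R : realType) :
  exists2 o : nat -> R, o k @[k --> \oo] --> (0 : R) &
  forall (p nu : nat) (n : 'I_nu.+1 -> nat),
    prime p -> (2 <= nu)%N -> (forall i, (0 < n i)%N) ->
    let P : R := p%:R in
    let Delta : R := (Deltapar p n)%:R in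
    let Gamma : R := (Gammapar p n)%:R in
    let M : R := maxsum R p n in
    [/\ P `^ (29 / 48) <= Delta < P `^ (2 / 3) ->
          M <= P `^ o p * (Delta `^ (- (1 / 4)) *
                 Gamma `^ (- (1 / (4 * nu%:R))) * P `^ (7 / 6)),
        P `^ (59 / 112) <= Delta < P `^ (29 / 48) ->
          M <= P `^ o p * (Delta `^ (- (21 / 52)) *
                 Gamma `^ (- (1 / (4 * nu%:R))) * P `^ (131 / 104)),
        P `^ (1 / 2) <= Delta < P `^ (59 / 112) ->
          M <= P `^ o p * (Delta `^ (- (7 / 20)) *
                 Gamma `^ (- (1 / (4 * nu%:R))) * P `^ (197 / 160)) &
        Delta < P `^ (1 / 2) ->
          M <= P `^ o p * (Delta `^ (- (31 / 80)) *
                 Gamma `^ (- (1 / (4 * nu%:R))) * P `^ (5 / 4))].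
Proof.
(* With this choice p^(o(p)) is the constant 8 = 5 + 3, the sum of the constants in [maxsum_le]. *)
exists (fun k => ln 8 / ln k%:R); first exact: cvg_div_ln.
move=> p nu n pr nu2 n0 P Delta Gamma M.
have p1 := prime_gt1 pr; have nu0 : (0 < nu)%N by lia.
have [Delta0 Gamma0 DG] := Delta_Gamma_le n p1 nu0.
have P0 : 0 < P by rewrite ltr0n; lia.
have D0 : 0 < Delta by rewrite ltr0n.
have G0 : 0 < Gamma by rewrite ltr0n.
set x := ln P; set d := ln Delta.
pose g := ln Gamma / (4 * nu%:R).
have x0 : 0 < x by rewrite ln_gt0// ltr1n.
have d0 : 0 <= d by rewrite ln_ge0// ler1n.
have dG : d + ln Gamma <= x.
  rewrite -lnM ?posrE// ler_ln ?posrE ?mulr_gt0//.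
  by rewrite -natrM ler_nat; lia.
have nuR : 2 <= nu%:R :> R by rewrite ler_nat.
have lnG0 : 0 <= ln Gamma by rewrite ln_ge0// ler1n.
have g0 : 0 <= g by rewrite divr_ge0// mulr_ge0// ler0n.
(* From Delta Gamma <= p and nu >= 2. It handles the Gauss sum term below; for the zeros term g >= 0
   is enough. *)
have g8 : g <= (x - d) / 8.
  rewrite ler_pdivrMr; last lra.
  have : 0 <= x - d by lra.
  nra.
have Mp : M <= expR x by rewrite lnK ?posrE// maxsum_le_card// ltnW.
have MT T : d < 2 / 3 * x -> x - 4 * g <= T -> 5 / 4 * x - 7 / 12 * d <= T ->
    M <= 8 * expR T.
  move=> dx T1 T2; have D4 : (Deltapar p n ^ 4 <= p ^ 3)%N.
    rewrite -(ler_nat R) -ler_ln ?posrE ?ltr0n ?expn_gt0 ?Delta0 ?(ltnW p1)//.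
    rewrite !natrX !lnXn// -/Delta -/P -/x -/d; lra.
  apply: le_trans (maxsum_le R pr nu0 D4) _; rewrite -/x -/d.
  have -> : ln (Gammapar p n)%:R / nu%:R = 4 * g by rewrite /g; field; lra.
  rewrite -ler_expR in T1; rewrite -ler_expR in T2; lra.
have MT' T : x <= T -> M <= 8 * expR T.
  rewrite -ler_expR => T1; have := expR_ge0 T; lra.
have E u v : P `^ (ln 8 / ln p%:R) * (Delta `^ (- u) * Gamma `^ (- (1 / (4 * nu%:R))) * P `^ v) =
    8 * expR (v * x - u * d - g).
  rewrite !powR_expR// -/x -/d divfK ?gt_eqF// lnK ?posrE// -!expRD.
  by congr (_ * expR _); rewrite /g; field; lra.
have lt u : (Delta < P `^ u) = (d < u * x).
  by rewrite powR_expR// -[X in X < _]lnK ?posrE// ltr_expR.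
have le u : (P `^ u <= Delta) = (u * x <= d).
  by rewrite powR_expR// -[X in _ <= X]lnK ?posrE// ler_expR.
rewrite !E !lt !le; split.
- by case/andP => ? ?; apply: MT; lra.
- by case/andP => ? ?; apply: MT; lra.
- by case/andP => ? ?; apply: MT; lra.
(* The trivial bound works for d <= (10/21) x and the Gauss sum term for d >= (30/77) x; 2/5 lies
   between these two ratios. *)
- move=> dx; have [le25|gt25] := leP d (2 / 5 * x); first by apply: MT'; lra.
  by apply: MT; lra.
Qed.
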